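(* Let $E$ and $F$ be JB$^*$-triples and let $\Delta:E\to F$ be a (not necessarily linear) bijection preserving the truncation of triple products in both directions. Then $\Delta$ preserves tripotents and the partial order among tripotents in both directions (that is, $e\in E$ is a tripotent if and only if $\Delta(e)$ is a tripotent in $F$, and for tripotents $e,v\in E$ one has $e\le v$ if and only if $\Delta(e)\le\Delta(v)$). In particular, $\Delta$ maps bijectively (order) minimal and maximal tripotents to (order) minimal and maximal tripotents, respectively, that is, $\Delta(\mathcal{U}_{min}(E))=\mathcal{U}_{min}(F)$ and $\Delta(\mathcal{U}_{max}(E))=\mathcal{U}_{max}(F)$.
   Context: A JB$^*$-triple is a complex Banach space $E$ with a continuous triple product $\{\cdot,\cdot,\cdot\}:E^3\to E$, symmetric and linear in the outer variables, conjugate-linear in the middle one, such that, with $L(a,b)(c)=\{a,b,c\}$: (i) $L(w,v)\{x,y,z\}=\{L(w,v)x,y,z\}-\{x,L(v,w)y,z\}+\{x,y,L(w,v)z\}$; (ii) $L(x,x)$ is hermitian with non-negative spectrum; (iii) $\|\{x,x,x\}\|=\|x\|^3$. A tripotent is an element $e$ with $\{e,e,e\}=e$; for $j=0,1,2$ put $E_j(e)=\{a\in E: L(e,e)(a)=\frac{j}{2}a\}$. A tripotent $e$ is (algebraically) minimal if $E_2(e)=\mathbb{C}e\neq\{0\}$, and complete or maximal if $E_0(e)=\{0\}$; $\mathcal{U}_{min}(E)$ and $\mathcal{U}_{max}(E)$ denote the sets of all minimal and of all maximal tripotents of $E$ in this sense. Elements $x,y$ are orthogonal ($x\perp y$) if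 $L(x,y)=0$. For tripotents, $e\le u$ means that $u-e$ is a tripotent orthogonal to $e$. A tripotent is order minimal if it is minimal for $\le$ among the non-zero tripotents, and order maximal if it is maximal for $\le$ among the tripotents. For $a,b$ in a JB$^*$-triple, $a$ is a truncation of $b$ if $\{a,a,a\}=\{a,b,a\}$. A bijection $\Delta:E\to F$ preserves the truncation of triple products in both directions if for all $a,b,c\in E$: $a$ is a truncation of $\{b,c,b\}$ if and only if $\Delta(a)$ is a truncation of $\{\Delta(b),\Delta(c),\Delta(b)\}$. *)

(* Defs.v *)
(* MathComp-Analysis over the complex numbers R[i], with R : realType. *)
From HB Require Import structures.
From mathcomp Require Import all_boot all_order all_algebra.
From mathcomp Require Import all_classical all_reals all_analysis.
From mathcomp Require Import complex.

Set Implicit Arguments.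
Unset Strict Implicit.
Unset Printing Implicit Defensive.

Import Order.TTheory GRing.Theory Num.Theory.
Import numFieldNormedType.Exports.

Local Open Scope classical_set_scope.
Local Open Scope ring_scope.

(* Norms of a normedModType R[i] take their values in R[i] (they are
   non-negative reals there), and on R[i] the relation [0 <= k] means that k is
   a non-negative real number. *)
Section BoundedOperators.
Variables (R : realType) (E : completeNormedModType R[i]).

(* Numerical range {f (T x) : |f| = |x| = f x = 1}. If f x = 1 = |x|, the bound
   |f y| <= |y| for all y forces the norm of f to be exactly 1. *)
Definition numerical_range (T : E -> E) : set R[i] :=
  [set k | exists (f : {linear E -> R[i]^o}) (x : E),
     [/\ forall y, `|f y : R[i]| <= `|y|, `|x| = 1, f x = 1 & k = f (T x)]].

Definition hermitian_operator (T : E -> E) : Prop :=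
  numerical_range T `<=` [set k | k \is Num.real].

Definition resolvent_set (T : E -> E) : set R[i] :=
  [set k | exists S : {linear E -> E},
     [/\ continuous S, cancel (fun x => T x - k *: x) S
       & cancel S (fun x => T x - k *: x)]].

Definition spectrum (T : E -> E) : set R[i] := ~` resolvent_set T.

End BoundedOperators.

(* {a, b, c} is [t a b c], and L(a, b) is the partial application [t a b]. *)
Record is_JBstar_triple (R : realType) (E : completeNormedModType R[i])
    (t : E -> E -> E -> E) : Prop := IsJBstarTriple {
  JB_continuous : continuous (fun p : E * E * E => t p.1.1 p.1.2 p.2);
  JB_sym : forall x y z, t x y z = t z y x;
  JB_linear : forall (k : R[i]) x x' y z,
    t (k *: x + x') y z = k *: t x y z + t x' y z;
  JB_conj_linear : forall (k : R[i]) x y y' z,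
    t x (k *: y + y') z = k^* *: t x y z + t x y' z;
  JB_jordan : forall w v x y z,
    t w v (t x y z) = t (t w v x) y z - t x (t v w y) z + t x y (t w v z);
  JB_hermitian : forall x, hermitian_operator (t x x);
  JB_spectrum : forall x, spectrum (t x x) `<=` [set k | 0 <= k];
  JB_norm : forall x, `|t x x x| = `|x| ^+ 3
}.

Section Tripotents.
Variables (R : realType) (E : completeNormedModType R[i]).
Variable t : E -> E -> E -> E.

Definition tripotent (e : E) : Prop := t e e e = e.

Definition peirce (j : nat) (e : E) : set E :=
  [set a | t e e a = (j%:R / 2%:R : R[i]) *: a].

Definition orthogonal_elements (x y : E) : Prop := forall z, t x y z = 0.

Definition tripotent_le (e u : E) : Prop :=
  tripotent (u - e) /\ orthogonal_elements (u - e) e.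

Definition minimal_tripotents : set E :=
  [set e | [/\ tripotent e, peirce 2 e = range (fun k : R[i] => k *: e)
             & range (fun k : R[i] => k *: e) <> [set 0]]].

Definition maximal_tripotents : set E :=
  [set e | tripotent e /\ peirce 0 e = [set 0]].

Definition order_minimal_tripotents : set E :=
  [set e | [/\ tripotent e, e <> 0
     & forall u, tripotent u -> u <> 0 -> tripotent_le u e -> u = e]].

Definition order_maximal_tripotents : set E :=
  [set e | tripotent e /\
     forall u, tripotent u -> tripotent_le e u -> u = e].

Definition truncation (a b : E) : Prop := t a a a = t a b a.

End Tripotents.

Definition preserves_truncation_of_triple_products (R : realType)
    (E F : completeNormedModType R[i]) (tE : E -> E -> E -> E)
    (tF : F -> F -> F -> F) (Delta : E -> F) : Prop :=
  forall a b c, truncation tE a (tE b c b) <->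
    truncation tF (Delta a) (tF (Delta b) (Delta c) (Delta b)).

(* Main.v *)
Require Import Defs.
From mathcomp Require Import all_boot all_order all_algebra.
From mathcomp Require Import all_classical all_reals all_analysis.
From mathcomp Require Import complex.
From mathcomp Require Import ring lra zify.

Set Implicit Arguments.
Unset Strict Implicit.
Unset Printing Implicit Defensive.

Import Order.TTheory GRing.Theory Num.Theory.
Import numFieldNormedType.Exports.

Local Open Scope classical_set_scope.
Local Open Scope ring_scope.

(* Write Q(a)c = {a,c,a}. Every notion is characterized by the relation
   "a is a truncation of {b,c,b}" alone, so that a bijection preserving this
   relation preserves the notion:
   - a is a tripotent iff it is a truncation of {a,a,a}: if a^3 = a^5 then
     a^3 - a has zero cube;
   - say that b absorbs e when, for all c, e is a truncation of {b,c,b} iff it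
     is a truncation of {e,c,e}. Comparing the solution sets in c kills the
     Peirce-1 part x of b: one gets {x,c,x} = 0 for c in E_0(e), hence
     Q({x,e,x}) = Q(x)Q(e)Q(x) annihilates {x,e,x}, so {x,e,x} = 0, and then
     {x,x,x} = 0. Thus e <= u iff e is a truncation of u = {u,u,u} and u
     absorbs e, and e is complete iff for every b absorbing e, each truncation
     of some {b,c,b} is a truncation of some {e,c',e};
   - e <> 0 is minimal iff for every nonzero truncation a of some {e,c,e} there
     is c' with e a truncation of {a,c',a}. Every a in E_2(e) is a truncation
     of {e,{e,a,e},e}, so this condition makes all nonzero a in E_2(e)
     invertible, and E_2(e) = C e follows as in the Gelfand-Mazur theorem. *)

(** * Anisotropic Jordan triples *)

(** The algebraic part of a JB*-triple: the norm axiom survives only as anisotropy, so that a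
    nonzero element has a nonzero cube. *)
Record jordan_triple (C : numClosedFieldType) (E : lmodType C)
    (t : E -> E -> E -> E) : Prop := JordanTriple {
  jt_sym : forall x y z, t x y z = t z y x;
  jt_linear : forall (k : C) x x' y z,
    t (k *: x + x') y z = k *: t x y z + t x' y z;
  jt_conj_linear : forall (k : C) x y y' z,
    t x (k *: y + y') z = k^* *: t x y z + t x y' z;
  jt_jordan : forall w v x y z,
    t w v (t x y z) = t (t w v x) y z - t x (t v w y) z + t x y (t w v z);
  jt_anisotropic : forall x, t x x x = 0 -> x = 0
}.

Section JordanTriple.
Variables (C : numClosedFieldType) (E : lmodType C).
Variable t : E -> E -> E -> E.
Hypothesis ht : jordan_triple t.

Lemma lmod_mulrn_eq0 n (x : E) : x *+ n.+1 = 0 -> x = 0.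
Proof.
move=> h; have /eqP : (n.+1%:R : C) *: x = 0 by rewrite scaler_nat.
by rewrite scaler_eq0 pnatr_eq0 => /= /eqP.
Qed.

Lemma tC x y z : t x y z = t z y x. Proof. exact: jt_sym. Qed.

Lemma tDl x x' y z : t (x + x') y z = t x y z + t x' y z.
Proof. by have := jt_linear ht 1 x x' y z; rewrite !scale1r. Qed.

Lemma tDr x y z z' : t x y (z + z') = t x y z + t x y z'.
Proof. by rewrite tC tDl !(tC _ y x). Qed.

Lemma tDm x y y' z : t x (y + y') z = t x y z + t x y' z.
Proof. by have := jt_conj_linear ht 1 x y y' z; rewrite rmorph1 !scale1r. Qed.

Lemma t0l y z : t 0 y z = 0.
Proof. by apply: (addrI (t 0 y z)); rewrite -tDl !addr0. Qed.

Lemma t0r x y : t x y 0 = 0. Proof. by rewrite tC t0l. Qed.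

Lemma t0m x z : t x 0 z = 0.
Proof. by apply: (addrI (t x 0 z)); rewrite -tDm !addr0. Qed.

Lemma tZl k x y z : t (k *: x) y z = k *: t x y z.
Proof. by have := jt_linear ht k x 0 y z; rewrite t0l !addr0. Qed.

Lemma tZr k x y z : t x y (k *: z) = k *: t x y z.
Proof. by rewrite tC tZl tC. Qed.

Lemma tZm k x y z : t x (k *: y) z = k^* *: t x y z.
Proof. by have := jt_conj_linear ht k x y 0 z; rewrite t0m !addr0. Qed.

Lemma tNl x y z : t (- x) y z = - t x y z.
Proof. by rewrite -scaleN1r tZl scaleN1r. Qed.

Lemma tNr x y z : t x y (- z) = - t x y z.
Proof. by rewrite tC tNl tC. Qed.

Lemma tNm x y z : t x (- y) z = - t x y z.
Proof. by rewrite -scaleN1r tZm rmorphN1 scaleN1r. Qed.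

Lemma tJ w v x y z :
  t w v (t x y z) = t (t w v x) y z - t x (t v w y) z + t x y (t w v z).
Proof. exact: jt_jordan. Qed.


Lemma tJm x w v y :
  t x (t v w y) x = t (t w v x) y x *+ 2 - t w v (t x y x).
Proof.
rewrite tJ (tC x y (t w v x)); set P := t _ y x; set B := t x _ x.
by rewrite mulr2n [P - B + P]addrAC opprB addrC subrK.
Qed.

(** Two instances of the Jordan identity relate the three products by A + B = 2W and W + B = 2A, so
    3(W - A) = 0. *)
Lemma triple_Q_mid x y z :
  t x z (t x y x) = t x y (t x z x) /\ t x (t y x z) x = t x y (t x z x).
Proof.
have J1 := tJ x y x z x; have J2 := tJ x z x y x.
rewrite (tC (t x y x)) in J1; rewrite (tC (t x z x)) (tC z) in J2.
set A := t x y (t x z x) in J1 J2 *; set W := t x z (t x y x) in J1 J2 *.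
set B := t x (t y x z) x in J1 J2 *.
have {}J1 : A + B = W + W by rewrite J1 addrAC subrK.
have {}J2 : W + B = A + A by rewrite J2 addrAC subrK.
have AW : W = A.
  apply/eqP; rewrite -subr_eq0; apply/eqP/(@lmod_mulrn_eq0 2).
  by rewrite mulrnBl !mulrS !mulr0n !addr0 -J2 -J1 addrCA subrr.
by split=> //; move: J2; rewrite AW => /addrI.
Qed.

Lemma triple_swap x y z : t (t x y x) y z = t x (t y x y) z.
Proof.
have := tJ x y x y z; rewrite -[LHS]add0r => /addIr/esym/eqP.
by rewrite subr_eq0 => /eqP.
Qed.

Lemma tQD a b c :
  t (a + b) c (a + b) = t a c a + (t a c b + t a c b) + t b c b.
Proof. by rewrite tDl !tDr (tC b c a) !addrA. Qed.

(** In operator form Q(x)Q(y) = 2 L(x,y)^2 - L(x,Q(y)x). For a tripotent e this turns Q(e)^2 into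
    2L^2 - L with L = L(e,e). *)
Lemma triple_QQ x y z :
  t x (t y z y) x = t x y (t x y z) *+ 2 - t x (t y x y) z.
Proof.
rewrite tJm (tC z y x) (tC (t x y z) y x); congr (_ - _).
by rewrite tC triple_swap.
Qed.

(** Expand L(x,y){x,z,{x,y,x}} by the Jordan identity: all terms except the wanted one reduce to
    expressions in q = Q(x)z, and they combine to Q(x)Q(y)q. *)
Lemma fundamental_formula x y z :
  t (t x y x) z (t x y x) = t x (t y (t x z x) y) x.
Proof.
have [_ M1] := triple_Q_mid x y z; rewrite triple_QQ; set q := t x z x in M1 *.
have := tJ x y x z (t x y x).
have [-> _] := triple_Q_mid x y z; rewrite -/q.
have -> : t x (t y x z) (t x y x) = t x y (t x y q).
  by have [-> _] := triple_Q_mid x y (t y x z); rewrite M1.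
have [_ <-] := triple_Q_mid x y y.
have [-> _] := triple_Q_mid x (t y x y) z; rewrite -/q.
set P := t x y _; set S := t _ z _; set R := t x _ q => h.
by rewrite mulr2n {2}h -addrA addrK addrC subrK.
Qed.

Lemma tripotent_of_cube a : t a (t a a a) a = t a a a -> t a a a = a.
Proof.
set c := t a a a => aca.
have caa : t c a a = c by rewrite /c triple_swap -/c aca.
have acc : t a c c = c.
  by have [-> _] := triple_Q_mid a a c; rewrite aca tC.
have cac : t c a c = c by rewrite {1 2}/c fundamental_formula !aca.
have ccc : t c c c = c by rewrite [LHS]fundamental_formula !aca.
(* All eight triple products of a and c equal c, so the cube of c - a consists of four copies of c
   and four of -c. *)
apply/eqP; rewrite -subr_eq0; apply/eqP/(jt_anisotropic ht).
rewrite -/c !(tDl, tDm, tDr, tNl, tNm, tNr) -/c.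
rewrite (tC a a c) (tC c c a) caa acc aca cac ccc.
by rewrite ?subrr ?opprK ?add0r ?subrr ?addr0.
Qed.

(** * Peirce decomposition with respect to a tripotent *)

Section Peirce.
Variable e : E.
Hypothesis he : t e e e = e.

Definition peirce_space (j : nat) (a : E) := t e e a = (j%:R / 2%:R : C) *: a.

Lemma peirce0P a : peirce_space 0 a <-> t e e a = 0.
Proof. by rewrite /peirce_space mul0r scale0r. Qed.

Lemma peirce2P a : peirce_space 2 a <-> t e e a = a.
Proof. by rewrite /peirce_space divff ?scale1r ?pnatr_eq0. Qed.

Lemma peirce2_self : peirce_space 2 e. Proof. exact/peirce2P. Qed.

Lemma peirceD j a b :
  peirce_space j a -> peirce_space j b -> peirce_space j (a + b).
Proof. by rewrite /peirce_space tDr => -> ->; rewrite scalerDr. Qed.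

Lemma peirceZ j k a : peirce_space j a -> peirce_space j (k *: a).
Proof. by rewrite /peirce_space tZr => ->; rewrite !scalerA mulrC. Qed.

Lemma peirce_space0 j : peirce_space j 0.
Proof. by rewrite /peirce_space t0r scaler0. Qed.

Lemma peirce2_Q a : peirce_space 2 (t e a e).
Proof. by apply/peirce2P; have [<- _] := triple_Q_mid e e a; rewrite he. Qed.

Lemma peirce2_QQ a : peirce_space 2 a -> t e (t e a e) e = a.
Proof. by move=> /peirce2P h; rewrite triple_QQ he !h mulr2n addrK. Qed.

(** With L = L(e,e), the projection onto E_2(e) is P_2 = Q(e)^2 = 2L^2 - L; then P_1 = 2(L - P_2),
    and P_0 is the remainder. *)
Lemma peirce_decomp a : exists a2 a1 a0,
  [/\ peirce_space 2 a2, peirce_space 1 a1, peirce_space 0 a0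
    & a = a2 + a1 + a0].
Proof.
set a2 := t e (t e a e) e; set a1 := (t e e a - a2) *+ 2.
have La2 : t e e a2 = a2 by apply/peirce2P/peirce2_Q.
have La1 : t e e a1 = t e e a - a2.
  have h : a2 + t e e a = t e e (t e e a) *+ 2.
    by rewrite /a2 triple_QQ he subrK.
  by rewrite /a1 mulr2n !tDr !tNr La2 addrACA -mulr2n -h [a2 + _]addrC -opprD addrKA.
exists a2, a1, (a - a2 - a1); split.
- exact/peirce2P.
- by rewrite /peirce_space La1 /a1 -[(_ - a2) *+ 2]scaler_nat scalerA mul1r
    mulVf ?scale1r ?pnatr_eq0.
- by apply/peirce0P; rewrite !tDr !tNr La2 La1 subrr.
- by rewrite -[a - a2 - a1]addrA -opprD [RHS]addrC subrK.
Qed.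

Lemma eigen_triple al be ga a b c :
  t e e a = al *: a -> t e e b = be *: b -> t e e c = ga *: c ->
  t e e (t a b c) = (al - be^* + ga) *: t a b c.
Proof.
move=> ha hb hc.
by rewrite tJ ha hb hc tZl tZm tZr scalerDl scalerBl.
Qed.

(** Since Q(e)^2 = 2L^2 - L maps into E_2(e), each eigenvalue of L = L(e,e) is a root of (2X^2 -
    X)(X - 1), that is, 0, 1/2 or 1. *)
Lemma eigen_eq0 mu a :
  t e e a = mu *: a -> (2%:R * mu ^+ 2 - mu) * (mu - 1) != 0 -> a = 0.
Proof.
move=> h mu0; have : t e e (t e (t e a e) e) = t e (t e a e) e.
  exact/peirce2P/peirce2_Q.
have -> : t e (t e a e) e = (2%:R * mu ^+ 2 - mu) *: a.
  by rewrite triple_QQ he h tZr h scalerA scalerBl -scaler_nat scalerA -expr2.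
rewrite tZr h => /eqP; rewrite -subr_eq0 scalerA -scalerBl -[X in _ - X]mulr1.
by rewrite -mulrBr scaler_eq0 (negPf mu0) /= => /eqP.
Qed.

Lemma peirce_triple_eigen i j k a b c :
  peirce_space i a -> peirce_space j b -> peirce_space k c ->
  t e e (t a b c) = (((i + k)%:R - j%:R) / 2%:R) *: t a b c.
Proof.
move=> ha hb hc; rewrite (eigen_triple ha hb hc); congr (_ *: _).
by rewrite rmorphM fmorphV !rmorph_nat natrD; field.
Qed.

Lemma peirce_triple l i j k a b c :
  peirce_space i a -> peirce_space j b -> peirce_space k c ->
  (i + k = l + j)%N -> peirce_space l (t a b c).
Proof.
move=> ha hb hc ijkl; rewrite /peirce_space (peirce_triple_eigen ha hb hc).
by rewrite ijkl natrD addrK.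
Qed.

Lemma peirce_triple_eq0 i j k a b c :
  peirce_space i a -> peirce_space j b -> peirce_space k c ->
  (i + k < j)%N || (j + 2 < i + k)%N -> t a b c = 0.
Proof.
move=> ha hb hc ijk; apply: eigen_eq0 (peirce_triple_eigen ha hb hc) _.
(* At mu = n/2 the polynomial of [eigen_eq0] is n(n-1)(n-2)/4; the excluded degrees n = -(m+1) and n
   = m+3 give this value up to sign. *)
have nz m : (m.+1 * m.+2 * m.+3)%N%:R / 4%:R != 0 :> C.
  by rewrite mulf_neq0 ?invr_eq0 ?pnatr_eq0.
case/orP: ijk => [/subnK|/subnK] <-.
  set m := (j - _)%N; rewrite -oppr_eq0; apply: contra_neq (nz m) => h0.
  by rewrite -[RHS]h0 addnS !natrM -!natr1 !natrD; field.
set m := (i + k - _)%N; apply: contra_neq (nz m) => h0.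
by rewrite -[RHS]h0 addnS !natrM -!natr1 !natrD; field.
Qed.

Lemma Q_peirce0 a : peirce_space 0 a -> t e a e = 0.
Proof. by move=> ha; apply: (peirce_triple_eq0 peirce2_self ha peirce2_self). Qed.

Lemma Q_peirce1 a : peirce_space 1 a -> t e a e = 0.
Proof. by move=> ha; apply: (peirce_triple_eq0 peirce2_self ha peirce2_self). Qed.

Lemma peirce2_Q_eq0 a : peirce_space 2 a -> t e a e = 0 -> a = 0.
Proof. by move=> h2 h; rewrite -(peirce2_QQ h2) h t0m. Qed.

(** The Peirce rules leave only z in E_0(e), with a value w in E_2(e). Applying L(e,d) to {e,e,z} =
    0 gives w = 0. *)
Lemma triple_self_peirce0 d z : peirce_space 0 d -> t e d z = 0.
Proof.
move=> hd; have [z2 [z1 [z0 [h2 h1 h0 ->]]]] := peirce_decomp z.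
rewrite !tDr (peirce_triple_eq0 peirce2_self hd h2) //.
rewrite (peirce_triple_eq0 peirce2_self hd h1) // !add0r.
have /peirce2P hw : peirce_space 2 (t e d z0).
  exact: (peirce_triple peirce2_self hd h0 _).
have := tJ e d e e z0; move/peirce0P: h0 => ->.
by rewrite (tC d e e) (iffLR (peirce0P _) hd) (Q_peirce0 hd) t0r t0m t0l hw
  subr0 add0r.
Qed.

(** The same argument with L(y,d); the additional term {e,{d,y,e},z} vanishes by the case y = e. *)
Lemma triple_peirce20 y d z :
  peirce_space 2 y -> peirce_space 0 d -> t y d z = 0.
Proof.
move=> hy hd; have [z2 [z1 [z0 [h2 h1 h0 ->]]]] := peirce_decomp z.
rewrite !tDr (peirce_triple_eq0 hy hd h2) //.
rewrite (peirce_triple_eq0 hy hd h1) // !add0r.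
have /peirce2P hw : peirce_space 2 (t y d z0) by exact: (peirce_triple hy hd h0 _).
have := tJ y d e e z0; move/peirce0P: (h0) => ->.
rewrite (peirce_triple_eq0 hy hd peirce2_self) // t0r t0l hw sub0r.
rewrite (@triple_self_peirce0 (t d y e)) ?oppr0 ?add0r //.
exact: (peirce_triple hd hy peirce2_self _).
Qed.

(** Here the critical component of z is the one in E_2(e); written as Q(e)w, it is killed by the
    Jordan identity. *)
Lemma triple_peirce0_self d z : peirce_space 0 d -> t d e z = 0.
Proof.
move=> hd; have [z2 [z1 [z0 [h2 h1 h0 ->]]]] := peirce_decomp z.
rewrite !tDr (peirce_triple_eq0 hd peirce2_self h1) //.
rewrite (peirce_triple_eq0 hd peirce2_self h0) // !addr0 -(peirce2_QQ h2).
set w := t e z2 e; have := tJ d e e w e.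
rewrite (tC d e e) (iffLR (peirce0P _) hd) (triple_self_peirce0 w hd).
by rewrite t0l t0m t0r subr0 addr0.
Qed.

(** * Absorption, and its effect on Peirce components *)

Definition absorbs b :=
  forall c, t e (t b c b) e = e <-> t e (t e c e) e = e.

(** The terms that d adds to Q(e)c lie in E_0(e) + E_1(e), which Q(e) annihilates. *)
Lemma absorbs_peirce0 d : peirce_space 0 d -> absorbs (e + d).
Proof.
move=> hd c; suff -> : t e (t (e + d) c (e + d)) e = t e (t e c e) e by [].
have [c2 [c1 [c0 [h2 h1 h0 ->]]]] := peirce_decomp c; set c' := c2 + c1 + c0.
have hec : t e (t e c' d) e = 0.
  rewrite /c' !tDm (@triple_self_peirce0 c0) // t0m addr0.
  rewrite (@Q_peirce0 (t e c2 d)) ?(@Q_peirce1 (t e c1 d)) ?addr0 //.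
  - exact: (peirce_triple peirce2_self h1 hd _).
  - exact: (peirce_triple peirce2_self h2 hd _).
have hdc : t e (t d c' d) e = 0.
  rewrite /c' !tDm (peirce_triple_eq0 hd h2 hd) //.
  rewrite (peirce_triple_eq0 hd h1 hd) // !t0m !add0r.
  exact/Q_peirce0/(peirce_triple hd h0 hd).
by clearbody c'; rewrite tQD !tDm hec hdc !addr0.
Qed.

(** Both e and e + c are sent to e by Q(e)Q(e), hence also by Q(e)Q(b); subtract. *)
Lemma absorbs_eq0 b c : absorbs b -> t e c e = 0 -> t e (t b c b) e = 0.
Proof.
move=> hb hc; have hbe : t e (t b e b) e = e by apply/hb; rewrite !he.
have : t e (t b (e + c) b) e = e by apply/hb; rewrite tDm hc he addr0 he.
by rewrite !tDm hbe -[RHS]addr0 => /addrI.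
Qed.

Lemma absorbs_peirce1 y x d : peirce_space 2 y -> peirce_space 1 x ->
  peirce_space 0 d -> absorbs (y + x + d) -> x = 0.
Proof.
move=> hy hx hd hb; set b := y + x + d in hb.
(* The E_2 component of Q(b)e is Q(y)e, and Q(e) kills the other components. *)
have yey : t y e y = e.
  have : t e (t b e b) e = e by apply/hb; rewrite !he.
  rewrite tQD tQD tDl !tDm.
  rewrite (peirce_triple_eq0 hx peirce2_self hd) //.
  rewrite (peirce_triple_eq0 hd peirce2_self hd) //.
  rewrite (@Q_peirce1 (t y e x)); last exact: (peirce_triple hy peirce2_self hx _).
  rewrite (@Q_peirce0 (t x e x)); last exact: (peirce_triple hx peirce2_self hx _).
  rewrite (@Q_peirce0 (t y e d)); last exact: (peirce_triple hy peirce2_self hd _).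
  rewrite !(t0m, addr0) => h; have hyy : peirce_space 2 (t y e y).
    exact: (peirce_triple hy peirce2_self hy _).
  by rewrite -(peirce2_QQ hyy) h he.
(* For c in E_1(e) the E_2 component of Q(b)c is 2{y,c,x}; for c in E_0(e), below, it is {x,c,x}.
   Both vanish by [absorbs_eq0]. *)
have ycx c : peirce_space 1 c -> t y c x = 0.
  move=> hc; have := absorbs_eq0 hb (Q_peirce1 hc).
  rewrite tQD tQD tDl !tDm.
  rewrite (peirce_triple_eq0 hy hc hy) // (peirce_triple_eq0 hd hc hd) //.
  rewrite (@Q_peirce1 (t y c d)); last exact: (peirce_triple hy hc hd _).
  rewrite (@Q_peirce1 (t x c x)); last exact: (peirce_triple hx hc hx _).
  rewrite (@Q_peirce0 (t x c d)); last exact: (peirce_triple hx hc hd _).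
  rewrite !(t0m, addr0, add0r) -mulr2n => /lmod_mulrn_eq0; apply: peirce2_Q_eq0.
  exact: (peirce_triple hy hc hx _).
have xcx c : peirce_space 0 c -> t x c x = 0.
  move=> hc; have := absorbs_eq0 hb (Q_peirce0 hc).
  rewrite tQD tQD tDl !tDm !(triple_peirce20 _ hy hc).
  rewrite (@Q_peirce1 (t x c d)); last exact: (peirce_triple hx hc hd _).
  rewrite (@Q_peirce0 (t d c d)); last exact: (peirce_triple hd hc hd _).
  rewrite !(t0m, addr0, add0r); apply: peirce2_Q_eq0.
  exact: (peirce_triple hx hc hx _).
(* Since Q(y)e = e, two uses of the Jordan identity replace y by e in {y,c,x} = 0. *)
have ecx c : peirce_space 1 c -> t e c x = 0.
  move=> hc; have hyec : peirce_space 1 (t e y c).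
    exact: (peirce_triple peirce2_self hy hc _).
  have := tJ y e y c x; rewrite yey (ycx _ hc) (ycx _ hyec) t0r subr0 => h.
  have : t y c (t y e x) = 0.
    rewrite tJ (peirce_triple_eq0 hy hc hy) // t0l (ycx _ hc) t0r addr0.
    rewrite (tC c y e) sub0r; apply/eqP; rewrite oppr_eq0; apply/eqP.
    exact: ycx.
  by move=> h'; rewrite h h' addr0.
set s := t x e x.
have hs : peirce_space 0 s by exact: (peirce_triple hx peirce2_self hx _).
have s0 : s = 0.
  by apply: (jt_anisotropic ht); rewrite fundamental_formula (xcx _ hs) !t0m.
apply: (jt_anisotropic ht).
(* Applying L(x,e) to {x,x,e} = 0 leaves half of {x,x,x}, because {x,e,x} = 0 and {x,e,e} = x/2. *)
have := tJ x e x x e; rewrite -/s s0 (tC x x e) (ecx _ hx) !(t0r, t0m, t0l).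
rewrite (tC x e e) hx tZr mul1r subrr add0r => /esym/eqP.
by rewrite scaler_eq0 invr_eq0 pnatr_eq0 /= => /eqP.
Qed.

(** For the converse, absorption removes the E_1 part of u and {e,u,e} = e forces its E_2 part to be
    e. So u = e + d with d in E_0(e), and d is a tripotent by orthogonality. *)
Lemma le_absorbs u : t u u u = u ->
  (t (u - e) (u - e) (u - e) = u - e /\ (forall z, t (u - e) e z = 0)) <->
  (t e u e = e /\ absorbs u).
Proof.
move=> hu; split.
  set d := u - e => -[hd hde].
  have hd0 : peirce_space 0 d by apply/peirce0P; rewrite tC.
  have -> : u = e + d by rewrite addrC subrK.
  by split; [rewrite tDm he Q_peirce0 ?addr0 | exact: absorbs_peirce0].
have [y [x [d [hy hx hd eu]]]] := peirce_decomp u.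
move=> [eue hb]; rewrite eu in hb; have x0 := absorbs_peirce1 hy hx hd hb.
rewrite {}x0 addr0 in eu.
have ye : y = e.
  by rewrite -(peirce2_QQ hy) -[RHS]he -[X in t _ X _ = _]addr0
    -(Q_peirce0 hd) -tDm -eu eue.
rewrite ye in eu; have -> : u - e = d by rewrite eu addrC addrA addNr add0r.
have hde z : t d e z = 0 by exact: triple_peirce0_self.
have hed z : t e d z = 0 by exact: triple_self_peirce0.
split=> //; move: hu; rewrite eu !(tDl, tDm, tDr) (tC d d e) (tC e e d).
by rewrite !hed !hde he !(addr0, add0r) => /addrI.
Qed.

(** If E_0(e) = 0, an absorbing b lies in E_2(e), where Q(e) is onto. Conversely, for d in E_0(e)
    the element a = {d,d,d} = Q(e + d)d is a truncation of itself up to its cube test: a truncation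
    of some Q(e)c' must have zero cube, so anisotropy applied twice gives d = 0. *)
Lemma complete_absorbs :
  (forall a, peirce_space 0 a -> a = 0) <->
  (forall b, absorbs b -> forall a c, t a a a = t a (t b c b) a ->
   exists c', t a a a = t a (t e c' e) a).
Proof.
split=> [h0 b hb a c ->|h d hd].
  have [y [x [d [hy hx hd eb]]]] := peirce_decomp b; rewrite {}eb in hb *.
  rewrite (absorbs_peirce1 hy hx hd hb) (h0 _ hd) !addr0.
  have [c2 [c1 [c0 [h2 h1 hc0 ->]]]] := peirce_decomp c.
  exists (t e (t y c2 y) e); rewrite peirce2_QQ; last first.
    exact: (peirce_triple hy h2 hy _).
  rewrite !tDm (peirce_triple_eq0 hy h1 hy) //.
  by rewrite (triple_peirce20 _ hy hc0) ?t0m ?addr0.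
apply: (jt_anisotropic ht); apply: (jt_anisotropic ht).
have hd3 : peirce_space 0 (t d d d) by exact: (peirce_triple hd hd hd _).
have [|c' ->] := h _ (absorbs_peirce0 hd) (t d d d) d.
  congr (t _ _ _).
  by rewrite tQD (triple_self_peirce0 e hd) (triple_self_peirce0 d hd) !add0r.
exact: (peirce_triple_eq0 hd3 (peirce2_Q c') hd3).
Qed.

(** Write a = y + x + d. If y is nonzero, a multiple of e serves as c'. If y = 0 and {x,c0,x} is
    nonzero for some c0 in E_0(e), it is a multiple of e and a multiple of c0 serves. Otherwise
    {x,e,x} = 0 by the fundamental formula, and a would have zero cube. *)
Lemma trunc_of_minimal : (forall a, peirce_space 2 a -> exists k, a = k *: e) ->
  forall a c, a <> 0 -> t a a a = t a (t e c e) a ->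
  exists c', t e (t a c' a) e = e.
Proof.
move=> hmin a c a0; have [la ->] := hmin _ (peirce2_Q c).
have [y [x [d [hy hx hd ea]]]] := peirce_decomp a; have [al ey] := hmin _ hy.
have [al0|al0] := eqVneq al 0; last first.
  move=> _; exists ((al ^* ^+ 2)^-1 *: e).
  have hal : al^* != 0 by rewrite conjC_eq0.
  rewrite tZm tZm {}ea tQD tQD tDl !tDm.
  rewrite (peirce_triple_eq0 hx peirce2_self hd) //.
  rewrite (peirce_triple_eq0 hd peirce2_self hd) //.
  rewrite (@Q_peirce1 (t y e x)); last exact: (peirce_triple hy peirce2_self hx _).
  rewrite (@Q_peirce0 (t x e x)); last exact: (peirce_triple hx peirce2_self hx _).
  rewrite (@Q_peirce0 (t y e d)); last exact: (peirce_triple hy peirce2_self hd _).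
  rewrite !(t0m, addr0) ey tZl tZr !tZm !he !scalerA conjCK -mulrA -expr2.
  by rewrite mulVf ?scale1r // expf_neq0.
rewrite ey al0 scale0r add0r in ea; rewrite {y hy ey al al0}ea in a0 *.
have [[c0 hc0 xcx0]|hall] := EM (exists2 c0, peirce_space 0 c0 & t x c0 x <> 0).
  have h2 : peirce_space 2 (t x c0 x) by exact: (peirce_triple hx hc0 hx _).
  have [k ek] := hmin _ h2; have k0 : k^* != 0.
    by rewrite conjC_eq0; apply/eqP => k0; apply: xcx0; rewrite ek k0 scale0r.
  exists (k^*^-1 *: c0); rewrite tZm tZm conjCK tQD !tDm ek.
  rewrite (@Q_peirce1 (t x c0 d)); last exact: (peirce_triple hx hc0 hd _).
  rewrite (@Q_peirce0 (t d c0 d)); last exact: (peirce_triple hd hc0 hd _).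
  by rewrite !addr0 tZm he scalerA mulVf // scale1r.
have xcx c0 : peirce_space 0 c0 -> t x c0 x = 0.
  by move=> hc0; apply: contrapT => xcx0; apply: hall; exists c0.
have s0 : t x e x = 0.
  apply: (jt_anisotropic ht); rewrite fundamental_formula (xcx (t x e x)) ?t0m //.
  exact: (peirce_triple hx peirce2_self hx _).
rewrite tZm (tQD x d e) s0 (peirce_triple_eq0 hx peirce2_self hd) //.
rewrite (peirce_triple_eq0 hd peirce2_self hd) // !addr0 scaler0.
by move/(jt_anisotropic ht).
Qed.

(** The hypothesis applies to a because a = Q(e)Q(e)a; only the E_2 part of the resulting c'
    contributes to Q(a)c'. *)
Lemma invertible_of_trunc :
  (forall a c, a <> 0 -> t a a a = t a (t e c e) a ->
    exists c', t e (t a c' a) e = e) ->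
  forall a, peirce_space 2 a -> a <> 0 ->
  exists2 c, peirce_space 2 c & t a c a = e.
Proof.
move=> h a ha a0; have [|c' hc'] := h a (t e a e) a0.
  by rewrite peirce2_QQ.
move: hc'; have [c2 [c1 [c0 [h2 h1 hc0 ->]]]] := peirce_decomp c'.
rewrite !tDm (peirce_triple_eq0 ha h1 ha) // (triple_peirce20 _ ha hc0) //.
rewrite !t0m !addr0 => hc; exists c2 => //.
have hac : peirce_space 2 (t a c2 a) by exact: (peirce_triple ha h2 ha _).
by rewrite -(peirce2_QQ hac) hc he.
Qed.

End Peirce.

End JordanTriple.

(** * Bounded operators have nonempty spectrum *)

Section ComplexModulus.
Variable R : realType.
Implicit Types (k l : R[i]) (a b : R).
Notation normc := (@Normc.normc R).

Lemma normc_normr k : `|k| = (normc k)%:C%C. Proof. by case: k. Qed.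

Lemma normc_ge0 k : 0 <= normc k.
Proof. by case: k => a b; exact: sqrtr_ge0. Qed.

Lemma normcX k n : normc (k ^+ n) = normc k ^+ n.
Proof.
elim: n => [|n IH]; first by rewrite !expr0 Normc.normc1.
by rewrite !exprS Normc.normcM IH.
Qed.

Lemma normcR a : normc a%:C%C = `|a|.
Proof. by rewrite /= expr0n /= addr0 sqrtr_sqr. Qed.

Lemma normc_le_ReIm a b : normc (Complex a b) <= `|a| + `|b|.
Proof.
rewrite /= -(ler_pXn2r (ltn0Sn 1)) ?nnegrE ?sqrtr_ge0 ?addr_ge0 //.
rewrite sqr_sqrtr ?addr_ge0 ?sqr_ge0 // sqrrD !real_normK ?num_real //.
by rewrite lerD2r lerDl mulrn_wge0 // mulr_ge0.
Qed.

Lemma normr_le_normc a b : `|a| <= normc (Complex a b) /\ `|b| <= normc (Complex a b).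
Proof.
have h c d : `|c| <= Num.sqrt (c ^+ 2 + d ^+ 2).
  by rewrite -sqrtr_sqr ler_wsqrtr // lerDl sqr_ge0.
by split; [|rewrite /= addrC]; exact: h.
Qed.

(** The disc lies in a compact square, and monotonicity in B lets finitely many local bounds be
    replaced by one. *)
Lemma disc_uniform_bound (P : R -> R[i] -> Prop) (L : R) :
  (forall B B' l, B <= B' -> P B l -> P B' l) ->
  (forall l, exists B r, 0 < r /\ forall m, normc (m - l) <= r -> P B m) ->
  exists B, forall l, normc l <= L -> P B l.
Proof.
move=> Pmon Ploc; pose K := `[- L, L] `*` `[- L, L].
have /compact_near_coveringP cK : compact K.
  by apply: compact_setX; exact: segment_compact.
have /filter_ex [B hB] : \forall B \near +oo,
    K `<=` (fun x : R * R => P B (Complex x.1 x.2)).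
  apply: cK => -[a b] _; have [B [r [r0 hB]]] := Ploc (Complex a b).
  exists (ball (a, b) (r / 2), [set i | B <= i]) => [|[[a' b'] i] /=].
    split; last exact/nbhs_pinfty_ge/num_real.
    by apply: nbhsx_ballx; rewrite divr_gt0.
  move=> [[ha hb] Bi]; apply: (Pmon B) => //; apply: hB.
  apply: le_trans (normc_le_ReIm _ _) _; rewrite [leRHS]splitr.
  by apply: lerD; apply: ltW; rewrite distrC.
exists B => -[a b] hl; apply: (hB (a, b)).
have [ha hb] := normr_le_normc a b.
split; rewrite /= in_itv /= -ler_norml; first exact: le_trans ha hl.
exact: le_trans hb hl.
Qed.

End ComplexModulus.

(** * Operators with an everywhere defined bounded resolvent *)

Section NonemptySpectrum.
Variables (R : realType) (Y : lmodType R[i]) (nu : Y -> R) (S : Y -> Prop).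
Variables (A : Y -> Y) (K : R).
Notation normc := (@Normc.normc R).
Hypothesis nu0_eq0 : forall x, nu x = 0 -> x = 0.
Hypothesis nuD : forall x y, nu (x + y) <= nu x + nu y.
Hypothesis nuZ : forall k x, nu (k *: x) = normc k * nu x.
Hypothesis S_linear : forall k x y, S x -> S y -> S (k *: x + y).
Hypothesis A_linear : forall k x y, A (k *: x + y) = k *: A x + A y.
Hypothesis A_stable : forall x, S x -> S (A x).
Hypothesis K_ge0 : 0 <= K.
Hypothesis A_bounded : forall x, nu (A x) <= K * nu x.

Let nu0 : nu 0 = 0.
Proof. by rewrite -(scale0r 0) nuZ Normc.normc0 mul0r. Qed.

Let nuN x : nu (- x) = nu x.
Proof. by rewrite -scaleN1r nuZ normcN Normc.normc1 mul1r. Qed.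

Let nuB x y : nu (x - y) <= nu x + nu y.
Proof. by apply: le_trans (nuD _ _) _; rewrite nuN. Qed.

Let nu_ge0 x : 0 <= nu x.
Proof. by have := nuB x x; rewrite subrr nu0; lra. Qed.

(** Exponents are powers of 2 so that 1 - m^2 A^(2n) factors as (1 + m A^n)(1 - m A^n). *)
Let op k := iter (2 ^ k) A.

Let opS k x : op k.+1 x = op k (op k x).
Proof. by rewrite /op expnS mul2n -addnn iterD. Qed.

Let op_linear k c x y : op k (c *: x + y) = c *: op k x + op k y.
Proof. by rewrite /op; elim: (2 ^ k)%N => //= n ->. Qed.

Let op0 k : op k 0 = 0.
Proof. by have := op_linear k (-1) 0 0; rewrite scaleN1r addNr scaleN1r addNr. Qed.

Let opZ k c x : op k (c *: x) = c *: op k x.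
Proof. by have := op_linear k c x 0; rewrite op0 !addr0. Qed.

Let opN k x : op k (- x) = - op k x.
Proof. by rewrite -scaleN1r opZ scaleN1r. Qed.

Let opD k x y : op k (x + y) = op k x + op k y.
Proof. by have := op_linear k 1 x y; rewrite !scale1r. Qed.

Let S0 x : S x -> S 0.
Proof. by move=> hx; rewrite -(subrr x) addrC -scaleN1r; exact: S_linear. Qed.

Let SZ c x : S x -> S (c *: x).
Proof. by move=> hx; rewrite -[_ *: _]addr0; apply: S_linear (S0 hx). Qed.

Let SD x y : S x -> S y -> S (x + y).
Proof. by move=> hx hy; rewrite -[x]scale1r; exact: S_linear. Qed.

Let op_stable k x : S x -> S (op k x).
Proof. by move=> hx; rewrite /op; elim: (2 ^ k)%N => //= n; exact: A_stable. Qed.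

(** With 1 - lA in place of A - l, a nonzero l stands for the inverse of a spectral value; the value
    0 is excluded by the lower bound on A in [zero_of_empty_spectrum]. *)
Hypothesis resolvent_bounded : forall l, exists B, forall x, S x ->
  nu x <= B * nu (x - l *: A x).
Hypothesis resolvent_onto : forall l y, S y -> exists2 x, S x & x - l *: A x = y.

(** Replacing l by eta l changes the sign of l^(2^k) without leaving the disc. *)
Let root_of_N1 k : exists2 eta : R[i], eta ^+ (2 ^ k) = -1 & normc eta = 1.
Proof.
have k0 : (0 < 2 ^ k)%N by rewrite expn_gt0.
have h : ((2 ^ k).-root (-1 : R[i])) ^+ (2 ^ k) = -1 by rewrite rootCK.
exists ((2 ^ k).-root (-1 : R[i])) => //.
have /eqP := congr1 normc h; rewrite normcX normcN Normc.normc1.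
by rewrite pexpr_eq1 ?normc_ge0 // => /eqP.
Qed.

Let op_factor k m x : x - m ^+ 2 *: op k.+1 x =
  (x - m *: op k x) + m *: op k (x - m *: op k x).
Proof.
by rewrite opS opD opN opZ scalerBr scalerA addrA subrK expr2.
Qed.

Let expr_pow2S (l : R[i]) k : l ^+ (2 ^ k.+1) = (l ^+ (2 ^ k)) ^+ 2.
Proof. by rewrite expnSr exprM. Qed.

Let op_injective k l x : S x -> x - l ^+ (2 ^ k) *: op k x = 0 -> x = 0.
Proof.
elim: k l x => [|k IH] l x Sx.
  rewrite expn0 expr1 => h; apply: nu0_eq0; have [B hB] := resolvent_bounded l.
  have := hB x Sx; rewrite -[A x]/(op 0 x) h nu0 mulr0 => h0.
  by apply/eqP; rewrite eq_le h0 nu_ge0.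
rewrite expr_pow2S op_factor; set m := l ^+ _; set w := x - _ => h.
have Sw : S w by rewrite /w -scaleNr addrC; apply: S_linear => //; exact: op_stable.
have [eta heta _] := root_of_N1 k.
have w0 : w = 0.
  apply: (IH (eta * l)) => //.
  by rewrite exprMn heta mulN1r scaleNr opprK.
exact: (IH l).
Qed.

(* Rickart's argument: the resolvent of A^(2n) at m^2 is the average of those of
   A^n at m and -m, so on a disc the maps l |-> (1 - l^(2^k) A^(2^k))^-1 share
   one bound and one radial Lipschitz constant for all k. *)
Let resolvent_pair B L : 0 <= B ->
  (forall l, normc l <= L -> forall x, S x -> nu x <= B * nu (x - l *: A x)) ->
  forall k l s y, normc l <= L -> 0 <= s <= 1 -> S y -> exists x x',
    [/\ S x, S x', x - l ^+ (2 ^ k) *: op k x = y &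
       x' - (s%:C%C * l) ^+ (2 ^ k) *: op k x' = y] /\
    [/\ nu x <= B * nu y, nu x' <= B * nu y &
       nu (x - x') <= B * K * B * (normc l * (1 - s)) * nu y].
Proof.
move=> B0 hB; elim=> [|k IH] l s y hl s01 Sy.
  have [s0 s1] := andP s01.
  have hsl : normc (s%:C%C * l) <= L.
    rewrite Normc.normcM normcR ger0_norm //.
    by apply: le_trans hl; rewrite ler_piMl ?normc_ge0.
  have [x Sx ex] := resolvent_onto l Sy.
  have [x' Sx' ex'] := resolvent_onto (s%:C%C * l) Sy.
  have hx' : nu x' <= B * nu y by rewrite -ex'; exact: hB.
  exists x, x'; split; first by split=> //; rewrite expn0 expr1.
  split=> //; first by rewrite -ex; exact: hB.
  have Sxx' : S (x - x') by rewrite -scaleN1r addrC; exact: S_linear.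
  apply: le_trans (hB l hl _ Sxx') _.
  (* This is the resolvent identity between the points l and s l. *)
  have -> : x - x' - l *: A (x - x') = ((1 - s)%:C%C * l) *: A x'.
    have -> : A (x - x') = A x - A x'.
      by rewrite -scaleN1r addrC A_linear scaleN1r addrC.
    rewrite scalerBr opprD addrACA -opprD ex -ex' opprB addrC addrA subrK.
    by rewrite rmorphB rmorph1 mulrBl mul1r scalerBl.
  rewrite nuZ Normc.normcM normcR ger0_norm ?subr_ge0 //.
  have hAx' : nu (A x') <= K * (B * nu y).
    by apply: le_trans (A_bounded _) _; apply: ler_wpM2l.
  rewrite [leRHS](_ : _ = B * ((1 - s) * normc l * (K * (B * nu y)))); last ring.
  by rewrite !ler_wpM2l ?mulr_ge0 ?normc_ge0 ?subr_ge0.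
have [eta heta neta] := root_of_N1 k.
have hel : normc (eta * l) <= L by rewrite Normc.normcM neta mul1r.
have [x1 [x1' [[Sx1 Sx1' e1 e1'] [b1 b1' d1]]]] := IH l s y hl s01 Sy.
have [x2 [x2' [[Sx2 Sx2' e2 e2'] [b2 b2' d2]]]] := IH (eta * l) s y hel s01 Sy.
rewrite Normc.normcM neta mul1r in d2.
have half_nu u v c : nu u <= c -> nu v <= c -> nu (2^-1 *: (u + v)) <= c.
  move=> hu hv; rewrite nuZ Normc.normcV.
  have -> : normc 2 = 2.
    by rewrite -[X in normc X](rmorph_nat (real_complex R)) normcR ger0_norm.
  by rewrite mulrC ler_pdivrMr //; have := nuD u v; lra.
have avg c u v : u - c *: op k u = y -> v + c *: op k v = y ->
    2^-1 *: (u + v) - c ^+ 2 *: op k.+1 (2^-1 *: (u + v)) = y.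
  move=> eu ev.
  have {eu}eu : c *: op k u = u - y by rewrite -eu opprB addrC subrK.
  have {ev}ev : c *: op k v = y - v by rewrite -ev addrC addKr.
  have euv : c ^+ 2 *: op k.+1 (u + v) = u + v - (y + y).
    have -> : c ^+ 2 *: op k.+1 (u + v) = c *: op k (c *: op k (u + v)).
      by rewrite opS [op k (c *: _)]opZ scalerA -expr2.
    rewrite opD scalerDr eu ev addrA subrK opD opN scalerBr eu ev opprB.
    by rewrite addrACA -opprD.
  rewrite [op k.+1 _]opZ scalerA mulrC -scalerA euv -scalerBr opprB addrC subrK.
  by rewrite -mulr2n -[y *+ 2]scaler_nat scalerA mulVf ?scale1r // pnatr_eq0.
exists (2^-1 *: (x1 + x2)), (2^-1 *: (x1' + x2')); split; split.
- by apply/SZ/SD.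
- by apply/SZ/SD.
- rewrite expr_pow2S; apply: avg => //.
  by move: e2; rewrite exprMn heta mulN1r scaleNr opprK.
- rewrite expr_pow2S; apply: avg => //.
  by move: e2'; rewrite mulrCA exprMn heta mulN1r scaleNr opprK.
- exact: half_nu.
- exact: half_nu.
- rewrite -scalerBr opprD addrACA; exact: half_nu.
Qed.

Definition contractive_power (rho th : R) (k : nat) :=
  forall x, S x -> rho ^+ (2 ^ k) * nu (op k x) <= th * nu x.

Let contractive_powerS rho th k : 0 <= rho -> 0 <= th ->
  contractive_power rho th k -> contractive_power rho (th ^+ 2) k.+1.
Proof.
move=> rho0 th0 h x Sx; rewrite opS expnSr exprM expr2 -mulrA.
have := h _ (op_stable k Sx); have := h _ Sx.
have := exprn_ge0 (2 ^ k) rho0; set r := rho ^+ _; set a := nu (op _ (op _ _)).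
set b := nu (op _ _); move=> r0 hb ha.
apply: (@le_trans _ _ (r * (th * b))); first exact: ler_wpM2l.
by rewrite mulrCA expr2 -mulrA; exact: ler_wpM2l.
Qed.

(** Each doubling of the exponent squares the constant, so starting from 1/3 it becomes arbitrarily
    small. *)
Let contractive_power_small rho k eps : 0 <= rho -> 0 < eps ->
  contractive_power rho 3^-1 k -> exists k', contractive_power rho eps k'.
Proof.
move=> rho0 eps0 h.
have hm m : contractive_power rho (3^-1 ^+ m.+1) (k + m).
  elim: m => [|m IH]; first by rewrite addn0 expr1.
  move=> x Sx; rewrite addnS.
  have t0 : 0 <= (3^-1 : R) ^+ m.+1 by rewrite exprn_ge0 // invr_ge0.
  apply: le_trans (contractive_powerS rho0 t0 IH Sx) _.
  apply: ler_wpM2r => //; rewrite -exprM; apply: ler_wiXn2l; rewrite ?invr_ge0 //.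
    by rewrite invf_le1 // ler1n.
  by lia.
have [m hme] : exists m, (3^-1 : R) ^+ m.+1 <= eps.
  have := archi_boundP (ltW (divr_gt0 ltr01 eps0)); set m := Num.bound _ => hb.
  exists m; rewrite exprVn.
  have h3 : (m%:R : R) <= 3 ^+ m.+1.
    rewrite -natrX ler_nat; apply: leq_trans (leqnSn m) _.
    by apply: ltnW; rewrite ltn_expl.
  rewrite -[eps]invrK lef_pV2 ?posrE ?invr_gt0 ?exprn_gt0 //.
  by apply: le_trans h3; rewrite -div1r ltW.
by exists (k + m)%N => x Sx; apply: le_trans (hm m x Sx) _; apply: ler_wpM2r.
Qed.

(* A small power of rho A keeps (1 - (rho A)^(2^k))^-1 close to 1, hence also
   (1 - (rho' A)^(2^k))^-1 by equicontinuity, so (rho' A)^(2^k) is small. *)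
Let contractive_power_step B L delta rho rho' k : 0 <= B ->
  (forall l, normc l <= L -> forall x, S x -> nu x <= B * nu (x - l *: A x)) ->
  B * K * B * delta <= 8^-1 -> 0 <= rho <= rho' -> rho' <= rho + delta ->
  rho' <= L -> contractive_power rho 3^-1 k ->
  exists k', contractive_power rho' 3^-1 k'.
Proof.
move=> B0 hB hdelta /andP[rho0 rhorho'] hd hL hk.
have rho'0 : 0 <= rho' by exact: le_trans rhorho'.
(* Times the resolvent bound B this threshold is at most 1/8; B + 1 avoids division by zero. *)
have e0 : 0 < (8 * (B + 1))^-1 :> R by rewrite invr_gt0 mulr_gt0 // ltr_wpDl.
have [k' {}hk] := contractive_power_small rho0 e0 hk.
have eB : (8 * (B + 1))^-1 * B <= 8^-1.
  rewrite invfM -mulrA ler_piMr ?invr_ge0 // mulrC ler_pdivrMr ?ltr_wpDl //.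
  by rewrite mul1r lerDl.
have [s s01 hs] : exists2 s, 0 <= s <= 1 & s * rho' = rho.
  have [r0|r0] := eqVneq rho' 0.
    exists 0; first by rewrite lexx ler01.
    by rewrite mul0r; apply/eqP; rewrite eq_le rho0 -r0.
  exists (rho / rho'); last by rewrite divfK.
  by rewrite divr_ge0 //= ler_pdivrMr ?mul1r // lt_neqAle eq_sym r0.
have nrho' : normc rho'%:C%C = rho' by rewrite normcR ger0_norm.
exists k' => z Sz; set w := rho'%:C%C ^+ (2 ^ k') *: op k' z.
have nw : nu w = rho' ^+ (2 ^ k') * nu (op k' z).
  by rewrite nuZ normcX nrho'.
rewrite -nw.
have Sw : S (z - w).
  by rewrite /w -scaleNr addrC; apply: S_linear => //; exact: op_stable.
have [|x [x' [[Sx Sx' ex ex'] [bx bx' dx]]]] :=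
  resolvent_pair B0 hB k' (l := rho'%:C%C) _ s01 Sw.
  by rewrite nrho'.
(* For the right-hand side z - w the solution at rho' is z itself, by injectivity. *)
have xz : x = z.
  apply/eqP; rewrite -subr_eq0; apply/eqP.
  apply: (@op_injective k' rho'%:C%C).
    by rewrite -scaleN1r addrC; exact: S_linear.
  by rewrite opD opN scalerBr opprD addrACA -opprD ex /w subrr.
have hx' : nu (x' - (z - w)) <= 8^-1 * nu (z - w).
  rewrite -{1}ex' subKr nuZ normcX Normc.normcM normcR nrho'.
  rewrite ger0_norm; last by case/andP: s01.
  rewrite hs; apply: le_trans (hk _ Sx') _.
  apply: (@le_trans _ _ ((8 * (B + 1))^-1 * (B * nu (z - w)))).
    by apply: ler_wpM2l => //; exact: ltW.
  by rewrite mulrA; exact: ler_wpM2r.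
have hxx' : nu (x - x') <= 8^-1 * nu (z - w).
  apply: le_trans dx _; apply: ler_wpM2r => //; apply: le_trans hdelta.
  apply: ler_wpM2l; first by rewrite !mulr_ge0.
  by rewrite nrho' mulrBr mulr1 mulrC hs lerBlDl.
(* Two errors of 1/8 give nu w <= (nu z + nu w)/4, that is, nu w <= (nu z)/3, which restores the
   constant 1/3. *)
have : nu w <= nu (x - x') + nu (x' - (z - w)).
  apply: le_trans (nuD _ _); rewrite addrA subrK xz opprB addrC subrK.
  exact: lexx.
by have := nuB z w; lra.
Qed.

(** Contractivity of a power of rho A is carried in small steps from rho = 0 to rho = L = 1/c. There
    the lower bound on A gives nu x <= (nu x)/3. *)
Lemma zero_of_empty_spectrum c : 0 < c ->
  (forall x, S x -> c * nu x <= nu (A x)) -> forall x, S x -> x = 0.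
Proof.
move=> c0 hc x Sx; pose L := c^-1.
have L0 : 0 < L by rewrite invr_gt0.
have [B1 hB1] : exists B, forall l, normc l <= L ->
    0 <= B /\ forall x, S x -> nu x <= B * nu (x - l *: A x).
  apply: disc_uniform_bound => [B B' l BB' [B0 h]|l].
    split=> [|z Sz]; first exact: le_trans BB'.
    by apply: le_trans (h z Sz) _; exact: ler_wpM2r.
  have [B hB] := resolvent_bounded l.
  pose B' := `|B| + 1; have B'0 : 0 < B' by rewrite ltr_wpDl.
  (* Moving l by at most r changes 1 - lA by at most 1/(2B'), so the resolvent bound B' at most
     doubles. *)
  pose r := (2 * B' * (K + 1))^-1.
  have r0 : 0 < r by rewrite invr_gt0 !mulr_gt0 // ltr_wpDl.
  have rB : r * (K + 1) * B' = 2^-1.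
    by rewrite /r; field; rewrite !gt_eqF // ltr_wpDl.
  exists (2 * B'), r; split=> // m hm; split=> [|z Sz].
    by rewrite mulr_ge0 // ltW.
  set v := z - m *: A z.
  have hv : nu (z - l *: A z) <= nu v + r * (K + 1) * nu z.
    have -> : z - l *: A z = v + (m - l) *: A z.
      by rewrite /v scalerBl addrA subrK.
    apply: le_trans (nuD _ _) _; rewrite lerD2l nuZ -mulrA.
    apply: ler_pM; rewrite ?normc_ge0 //; apply: le_trans (A_bounded _) _.
    by apply: ler_wpM2r => //; rewrite lerDl.
  have h1 : nu z <= B' * (nu v + r * (K + 1) * nu z).
    apply: le_trans (hB z Sz) _; apply: (@le_trans _ _ (B' * nu (z - l *: A z))).
      apply: ler_wpM2r => //; apply: le_trans (ler_norm B) _.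
      by rewrite lerDl.
    by apply: ler_wpM2l => //; exact: ltW.
  move: h1; rewrite (_ : _ * (_ + _) = B' * nu v + r * (K + 1) * B' * nu z);
    last ring.
  by rewrite rB; lra.
have B0 : 0 <= B1.
  have h0 : normc 0 <= L by rewrite Normc.normc0 ltW.
  by have [] := hB1 0 h0.
have {}hB1 l : normc l <= L -> forall x, S x -> nu x <= B1 * nu (x - l *: A x).
  by move=> /hB1[].
pose D := B1 * K * B1; have D0 : 0 <= D by rewrite !mulr_ge0.
(* Enough steps that D delta <= 1/8, as [contractive_power_step] requires. *)
pose n := (Num.bound (8 * D * L)).+1; pose delta := L / n%:R.
have n0 : 0 < n%:R :> R by rewrite ltr0n.
have delta0 : 0 < delta by rewrite divr_gt0.
have hdelta : D * delta <= 8^-1.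
  rewrite /delta mulrA ler_pdivrMr // -ler_pdivrMl ?invr_gt0 // invrK mulrA.
  apply: ltW; apply: lt_le_trans (archi_boundP _) _.
    exact: mulr_ge0 (mulr_ge0 (ler0n _ _) D0) (ltW L0).
  by rewrite ler_nat leqW.
have chain i : (i <= n)%N -> exists k, contractive_power (delta * i%:R) 3^-1 k.
  elim: i => [_|i IH ilt].
    exists 0%N => z _; rewrite mulr0 expr0n /= mul0r.
    by rewrite mulr_ge0 ?invr_ge0.
  have [k] := IH (ltnW ilt); apply: (contractive_power_step B0 hB1 hdelta).
  - rewrite (mulr_ge0 (ltW delta0) (ler0n _ _)) /=.
    by apply: ler_wpM2l; [exact: ltW | rewrite ler_nat].
  - by rewrite -natr1 mulrDr mulr1.
  - by rewrite /delta mulrAC ler_pdivrMr // ler_pM2l // ler_nat.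
have [k] := chain n (leqnn n); rewrite /delta divfK ?gt_eqF // => /(_ x Sx).
have hop : c ^+ (2 ^ k) * nu x <= nu (op k x).
  rewrite /op; elim: (2 ^ k)%N => [|m IH]; first by rewrite expr0 mul1r.
  rewrite exprS -mulrA; apply: le_trans (hc _ _); last first.
    by elim: m {IH} => //= m; exact: A_stable.
  by apply: ler_wpM2l => //; exact: ltW.
have : nu x <= L ^+ (2 ^ k) * nu (op k x).
  rewrite /L exprVn -ler_pdivrMl ?invr_gt0 ?exprn_gt0 // invrK //.
move=> h1 h2; apply: nu0_eq0; have := nu_ge0 x; lra.
Qed.

End NonemptySpectrum.

(** * JB*-triples *)

Section RealNorm.
Variables (R : realType) (E : normedModType R[i]).
Notation normc := (@Normc.normc R).

(* The norm of [E] takes its values in [R[i]]; [rnorm] is the same number in [R]. *)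
Definition rnorm (x : E) : R := normc `|x|.

Lemma rnormE x : `|x| = (rnorm x)%:C%C.
Proof. by rewrite -normc_normr normr_id. Qed.

Lemma rnorm_ge0 x : 0 <= rnorm x. Proof. exact: normc_ge0. Qed.

Lemma rnorm0_eq0 x : rnorm x = 0 -> x = 0.
Proof. by move=> /Normc.eq0_normc/normr0_eq0. Qed.

Lemma rnormD x y : rnorm (x + y) <= rnorm x + rnorm y.
Proof. by rewrite -lecR rmorphD /= -!rnormE ler_normD. Qed.

Lemma rnormZ k x : rnorm (k *: x) = normc k * rnorm x.
Proof.
by rewrite /rnorm normrZ Normc.normcM normc_normr normcR ger0_norm ?normc_ge0.
Qed.

Lemma rnormN x : rnorm (- x) = rnorm x.
Proof. by rewrite /rnorm normrN. Qed.

Lemma rnormB x y : rnorm (x - y) <= rnorm x + rnorm y.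
Proof. by rewrite -[rnorm y]rnormN rnormD. Qed.

End RealNorm.

(** * Boundedness of the triple product, and a Gelfand-Mazur theorem for E_2(e) *)

Section JBstarTriple.
Variables (R : realType) (E : completeNormedModType R[i]).
Notation normc := (@Normc.normc R).
Variable t : E -> E -> E -> E.
Hypothesis ht : is_JBstar_triple t.

Lemma jordan_triple_of_JBstar : jordan_triple t.
Proof.
split; [exact: JB_sym | exact: JB_linear | exact: JB_conj_linear
  | exact: JB_jordan | move=> x h].
have /eqP : `|x| ^+ 3 = 0 by rewrite -(JB_norm ht) h normr0.
by rewrite expf_eq0 /= normr_eq0 => /eqP.
Qed.

Let jt := jordan_triple_of_JBstar.

(** Continuity at 0 bounds the product by 1 on a ball of radius r; homogeneity then gives M =
    r^-3. *)
Lemma triple_bounded : exists2 M : R, 0 <= M &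
  forall x y z, rnorm (t x y z) <= M * rnorm x * rnorm y * rnorm z.
Proof.
have /(_ (0, 0, 0))/cvgrPdist_lt/(_ 1 ltr01)/nbhs_ballP[d /= d0 hd] :=
  @JB_continuous _ _ _ ht.
have ed : (normc d)%:C%C = d by rewrite -normc_normr ger0_norm // ltW.
pose r := normc d / 2; have r0 : 0 < r.
  by rewrite divr_gt0 // -ltcR ed.
have hr x y z :
    rnorm x <= r -> rnorm y <= r -> rnorm z <= r -> rnorm (t x y z) <= 1.
  have hball w : rnorm w <= r -> ball (0 : E) d w.
    move=> hw; rewrite -ball_normE /ball_ /= sub0r normrN rnormE -ed ltcR.
    apply: le_lt_trans hw _.
    by rewrite /r ltr_pdivrMr // mulr2n mulrDr mulr1 ltrDl -ltcR ed.
  move=> hx hy hz.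
  have := hd (x, y, z) (conj (conj (hball _ hx) (hball _ hy)) (hball _ hz)).
  rewrite /= (t0l jt) sub0r normrN rnormE.
  by rewrite -[1](rmorph1 (real_complex R)) ltcR => /ltW.
exists (r ^+ 3)^-1; first by rewrite invr_ge0 exprn_ge0 // ltW.
move=> x y z.
have [/eqP/rnorm0_eq0 ->|x0] := boolP (rnorm x == 0).
  by rewrite (t0l jt) /rnorm normr0 Normc.normc0 !(mulr0, mul0r).
have [/eqP/rnorm0_eq0 ->|y0] := boolP (rnorm y == 0).
  by rewrite (t0m jt) /rnorm normr0 Normc.normc0 !(mulr0, mul0r).
have [/eqP/rnorm0_eq0 ->|z0] := boolP (rnorm z == 0).
  by rewrite (t0r jt) /rnorm normr0 Normc.normc0 !(mulr0, mul0r).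
pose k (w : E) := (r / rnorm w)%:C%C.
have nk (w : E) : rnorm w != 0 -> normc (k w) = r / rnorm w.
  move=> w0; rewrite normcR ger0_norm // divr_ge0 ?rnorm_ge0 //; exact: ltW.
have hk (w : E) : rnorm w != 0 -> rnorm (k w *: w) <= r.
  by move=> w0; rewrite rnormZ nk // divfK.
have := hr _ _ _ (hk x x0) (hk y y0) (hk z z0).
rewrite (tZl jt) (tZm jt) (tZr jt) !rnormZ.
have -> : (k y)^* = k y by rewrite conj_Creal // complex_real.
rewrite !nk // => h.
have rn (w : E) : rnorm w != 0 -> 0 < rnorm w by move=> w0; rewrite lt_def w0 rnorm_ge0.
have p0 := exprn_gt0 3 r0; have x1 := rn x x0; have y1 := rn y y0; have z1 := rn z z0.
have -> : rnorm (t x y z) = (r ^+ 3)^-1 * rnorm x * rnorm y * rnorm z *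
    (r / rnorm x * (r / rnorm y * (r / rnorm z * rnorm (t x y z)))).
  by field; rewrite x0 y0 z0 gt_eqF.
rewrite ler_piMr //.
by rewrite !mulr_ge0 ?rnorm_ge0 // invr_ge0 ltW.
Qed.

(** The fundamental formula gives Q(a)Q(c)Q(a) = Q(e), and Q(e) is its own inverse on E_2(e). *)
Lemma quadratic_inverse e a c : t e e e = e ->
  peirce_space t e 2 a -> peirce_space t e 2 c -> t a c a = e ->
  (exists2 B : R, 0 <= B &
    forall z, peirce_space t e 2 z -> rnorm z <= B * rnorm (t a z a)) /\
  (forall y, peirce_space t e 2 y ->
    exists2 x, peirce_space t e 2 x & t a (t e x e) a = y).
Proof.
move=> he ha hc ace.
have fund z : t a (t c (t a z a) c) a = t e z e.
  by rewrite -fundamental_formula // ace.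
have st2 u v : peirce_space t e 2 u -> peirce_space t e 2 v ->
    peirce_space t e 2 (t u v u).
  by move=> hu hv; exact: (peirce_triple jt hu hv hu _).
split=> [|y hy]; last first.
  have hey := peirce2_Q jt he y; pose w := t c (t a (t e y e) a) c.
  have hw : peirce_space t e 2 w by apply: (st2 _ _ hc); exact: (st2 _ _ ha).
  exists (t e w e); first exact: peirce2_Q.
  by rewrite !(peirce2_QQ jt he) // /w fund (peirce2_QQ jt he).
have [M M0 hM] := triple_bounded.
pose q (u : E) := M * rnorm u * rnorm u.
have q0 (u : E) : 0 <= q u by rewrite !mulr_ge0 ?rnorm_ge0.
have hq u z : rnorm (t u z u) <= q u * rnorm z.
  by rewrite /q mulrAC; exact: hM.
clearbody q; exists (q e * (q a * q c)).
  exact: mulr_ge0 (q0 _) (mulr_ge0 (q0 _) (q0 _)).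
move=> z hz; rewrite -{1}(peirce2_QQ jt he hz) -[t e z e]fund -!mulrA.
apply: le_trans (hq _ _) _; apply: ler_wpM2l => //.
apply: le_trans (hq _ _) _; apply: ler_wpM2l => //.
Qed.

(* If b in E_2(e) is not scalar, every U(e - l b) = 1 - 2 l T + l^2 U is
   invertible on E_2(e), where T = L(b, e) and U = Q(b)Q(e). This quadratic
   pencil is linearized by the companion operator A(x, y) = (2 T x - U y, x),
   which would be invertible with empty spectrum. *)
Lemma peirce2_scalar e : t e e e = e -> e <> 0 ->
  (forall a, peirce_space t e 2 a -> a <> 0 ->
    exists2 c, peirce_space t e 2 c & t a c a = e) ->
  forall b, peirce_space t e 2 b -> exists k : R[i], b = k *: e.
Proof.
move=> he e0 hinv b hb; apply: contrapT => hnb.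
have b0 : b <> 0 by move=> b0; apply: hnb; exists 0; rewrite scale0r.
have heb l : e - l *: b <> 0.
  move=> h; have [l0|l0] := eqVneq l 0.
    by apply: e0; rewrite -h l0 scale0r subr0.
  apply: hnb; exists l^-1; rewrite -[e](subrK (l *: b)) h add0r scalerA.
  by rewrite mulVf // scale1r.
have he2 := peirce2_self he.
have heb2 l : peirce_space t e 2 (e - l *: b).
  by rewrite -scaleNr; apply: (peirceD jt) => //; exact: (peirceZ jt).
have inv a : peirce_space t e 2 a -> a <> 0 -> _ :=
  fun ha ha0 => let: ex_intro2 c hc ace := hinv a ha ha0 in
    quadratic_inverse he ha hc ace.
pose T x := t e (t e x e) b; pose U x := t b (t e x e) b.
have V l x : peirce_space t e 2 x ->
    t (e - l *: b) (t e x e) (e - l *: b) = x - l *: (T x + T x - l *: U x).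
  move=> hx; rewrite -scaleNr (tQD jt) !(tZl jt) !(tZr jt) (peirce2_QQ jt he hx).
  rewrite scalerA mulrNN -/(T x) -/(U x) -scalerDr scalerBr opprB scaleNr.
  by rewrite scalerA addrA addrAC.
have [M M0 hM] := triple_bounded.
pose A (p : E * E) : E * E := (T p.1 + T p.1 - U p.2, p.1).
pose nu (p : E * E) := rnorm p.1 + rnorm p.2.
pose S (p : E * E) := peirce_space t e 2 p.1 /\ peirce_space t e 2 p.2.
have bound u v : exists2 K : R, 0 <= K &
    forall x, rnorm (t u (t e x e) v) <= K * rnorm x.
  exists (M * rnorm u * (M * rnorm e * rnorm e) * rnorm v).
    by rewrite !mulr_ge0 ?rnorm_ge0.
  move=> x; apply: le_trans (hM _ _ _) _.
  rewrite [leRHS](_ : _ =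
    M * rnorm u * (M * rnorm e * rnorm x * rnorm e) * rnorm v); last by ring.
  apply: ler_wpM2r; first exact: rnorm_ge0.
  by apply: ler_wpM2l; [rewrite mulr_ge0 ?rnorm_ge0 | exact: hM].
have [KT KT0 hT] := bound e b; have [KU KU0 hU] := bound b b.
have lin u v k x y : t u (t e (k *: x + y) e) v =
    k *: t u (t e x e) v + t u (t e y e) v.
  by rewrite !(tDm jt) !(tZm jt) conjCK.
have Ulin k x y : U (k *: x + y) = k *: U x + U y by exact: lin.
have st u x : peirce_space t e 2 u -> peirce_space t e 2 (t u (t e x e) b).
  by move=> hu; exact: (peirce_triple jt hu (peirce2_Q jt he x) hb _).
(* On E_2(e) x E_2(e) the operator A meets the hypotheses of [zero_of_empty_spectrum], which makes
   the nonzero vector (e, 0) vanish. *)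
suff : (e, 0) = 0 :> E * E by move=> [].
have [[Bb Bb0 hBb] _] := inv b hb b0.
have Q2 x : peirce_space t e 2 (t e x e) by exact: peirce2_Q.
have [[Be Be0 hBe] _] := inv e he2 e0.
(* From A(x,y) = (a,x) follows Uy = 2Tx - a, and U = Q(b)Q(e) has inverse bounded by Bb Be; hence nu
   p <= c nu(A p). *)
pose c := 1 + 2 * KT + Bb * Be * (1 + 2 * KT).
have c0 : 0 < c.
  by rewrite /c -addrA ltr_wpDr ?addr_ge0 ?mulr_ge0 // addr_ge0 ?mulr_ge0.
have Tnorm x : rnorm (T x + T x) <= 2 * KT * rnorm x.
  by apply: le_trans (rnormD _ _) _; have := hT x; rewrite -/(T x); lra.
apply: (@zero_of_empty_spectrum R (E * E)%type nu S A (2 * KT + KU + 1)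
  _ _ _ _ _ _ _ _ _ _ c^-1).
- move=> [x y]; rewrite /nu /= => h; have := rnorm_ge0 x; have := rnorm_ge0 y => hy hx.
  by congr pair; apply: rnorm0_eq0; lra.
- move=> [x y] [x' y']; rewrite /nu /=.
  by have := rnormD x x'; have := rnormD y y'; lra.
- by move=> k [x y]; rewrite /nu /= !rnormZ mulrDr.
- move=> k [x y] [x' y'] [/= hx hy] [/= hx' hy'].
  by split=> /=; apply: (peirceD jt) => //; exact: (peirceZ jt).
- move=> k [x y] [x' y']; rewrite /A /= /T /U !lin; congr pair.
  rewrite -[(k *: _).1]/(k *: (T x + T x - U y)) /T /U /=.
  rewrite scalerBr scalerDr; set a1 := k *: _; set a2 := t _ _ _.
  set a3 := k *: _; set a4 := t _ _ _.
  by rewrite opprD [RHS]addrACA [a1 + a1 + (a2 + a2)]addrACA.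
- move=> [x y] [/= hx hy]; split => //=; rewrite -scaleN1r addrC.
  by apply: (peirceD jt); [apply: (peirceZ jt) | apply: (peirceD jt)]; exact: st.
- by rewrite !addr_ge0 ?mulr_ge0.
- move=> [x y]; rewrite /nu /A /=.
  have := rnormB (T x + T x) (U y); have := Tnorm x; have := hU y.
  rewrite -/(U y) => h1 h2 h3.
  have := mulr_ge0 KU0 (rnorm_ge0 x); have := mulr_ge0 KT0 (rnorm_ge0 y).
  have := rnorm_ge0 y; lra.
- move=> l.
  have [[B B0 hB] _] := inv _ (heb2 l) (heb l).
  pose N := normc l; have N0 : 0 <= N by exact: normc_ge0.
  exists (B * Be * (1 + N * KU) * (1 + N) + 1) => -[x y] [/= hx hy].
  set p := x - l *: (T x + T x - U y); set q := y - l *: x.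
  (* Eliminating y = q + l x reduces (1 - lA)(x,y) = (p,q) to the quadratic pencil in x alone. *)
  have hVx : t (e - l *: b) (t e x e) (e - l *: b) = p - l *: U q.
    have -> : U q = U y - l *: U x by rewrite /q addrC -scaleNr Ulin scaleNr addrC.
    by rewrite V // /p -[RHS]addrA -opprD -scalerDr addrA subrK.
  have h1 : rnorm x <= Be * (B * (rnorm p + N * (KU * rnorm q))).
    apply: le_trans (hBe x hx) _; apply: ler_wpM2l => //.
    apply: le_trans (hB _ (Q2 x)) _; apply: ler_wpM2l => //; rewrite hVx.
    apply: le_trans (rnormB _ _) _; rewrite lerD2l rnormZ.
    by apply: ler_wpM2l => //; exact: hU.
  have h2 : rnorm y <= rnorm q + N * rnorm x.
    by rewrite -[y in rnorm y](subrK (l *: x)) -rnormZ; exact: rnormD.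
  have h3 : rnorm x <= Be * (B * ((1 + N * KU) * (rnorm p + rnorm q))).
    apply: le_trans h1 _; do 2! apply: ler_wpM2l => //.
    have := mulr_ge0 (mulr_ge0 N0 KU0) (rnorm_ge0 p); have := rnorm_ge0 q; lra.
  rewrite /nu /= -/p -/q.
  have := ler_wpM2l (addr_ge0 ler01 N0) h3; have := rnorm_ge0 p; lra.
- move=> l [p q] [/= hp hq].
  have hpq : peirce_space t e 2 (p - l *: U q).
    by rewrite -scaleNr; apply: (peirceD jt) => //; apply: (peirceZ jt); exact: st.
  have [_ /(_ _ hpq)[x hx ex]] := inv _ (heb2 l) (heb l).
  exists (x, l *: x + q).
    by split => //=; apply: (peirceD jt) => //; exact: (peirceZ jt).
  rewrite -[LHS]/(x - l *: (T x + T x - U (l *: x + q)), l *: x + q - l *: x).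
  congr pair; last by rewrite addrC addKr.
  rewrite Ulin opprD addrA scalerDr scalerN opprD opprK.
  by rewrite addrA -V // ex subrK.
- by rewrite invr_gt0.
- move=> [x y] [/= hx hy]; rewrite ler_pdivrMl // /nu /A /=.
  set a := T x + T x - U y.
  have hUy : rnorm (U y) <= rnorm a + 2 * KT * rnorm x.
    have -> : U y = T x + T x - a by rewrite /a subKr.
    by apply: le_trans (rnormB _ _) _; rewrite addrC lerD2l; exact: Tnorm.
  have hy1 : rnorm y <= Be * (Bb * rnorm (U y)).
    apply: le_trans (hBe y hy) _.
    by apply: ler_wpM2l => //; exact: (hBb _ (Q2 y)).
  have hy2 : rnorm y <= Be * (Bb * ((1 + 2 * KT) * (rnorm a + rnorm x))).
    apply: le_trans hy1 _; do 2! apply: ler_wpM2l => //.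
    apply: le_trans hUy _.
    have := mulr_ge0 KT0 (rnorm_ge0 a); have := rnorm_ge0 x; lra.
  have := mulr_ge0 KT0 (rnorm_ge0 a); have := mulr_ge0 KT0 (rnorm_ge0 x).
  have := rnorm_ge0 a; rewrite /c; lra.
- split=> //=; exact: (peirce_space0 jt).
Qed.

End JBstarTriple.

(** * Characterizations by the truncation relation *)

Section TruncationCharacterizations.
Variables (R : realType) (E : completeNormedModType R[i]).
Variable t : E -> E -> E -> E.
Hypothesis ht : is_JBstar_triple t.
Let jt := jordan_triple_of_JBstar ht.

Lemma tripotentP e : tripotent t e <-> truncation t e (t e e e).
Proof.
split=> [he|/esym]; first by rewrite /truncation he he.
exact: (tripotent_of_cube jt).
Qed.

Definition trunc_absorbs (e b : E) : Prop :=
  forall c, truncation t e (t b c b) <-> truncation t e (t e c e).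

Lemma trunc_absorbsP e b : tripotent t e -> trunc_absorbs e b <-> absorbs t e b.
Proof.
move=> he; rewrite /trunc_absorbs /absorbs /truncation he.
by split=> h c; split=> /esym/h/esym.
Qed.

(** Here {u,u,u} stands for u, since the preserved relation concerns truncations of elements
    {b,c,b}. *)
Lemma tripotent_leP e u : tripotent t e -> tripotent t u ->
  tripotent_le t e u <-> truncation t e (t u u u) /\ trunc_absorbs e u.
Proof.
move=> he hu; rewrite trunc_absorbsP // /truncation he hu.
have [h1 h2] := le_absorbs jt he hu.
by split=> [/h1[]|[/esym eu hab]]; [split | apply: h2].
Qed.

Lemma maximal_tripotentsP e : maximal_tripotents t e <-> tripotent t e /\
  forall b, trunc_absorbs e b -> forall a c, truncation t a (t b c b) ->
  exists c', truncation t a (t e c' e).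
Proof.
have h0 : peirce t 0 e 0 by exact: (peirce_space0 jt e 0).
split=> -[he h]; split=> //; have [h1 h2] := complete_absorbs jt he.
  move=> b /(trunc_absorbsP b he); apply: h1 => a ha.
  by have : peirce t 0 e a by []; rewrite h.
apply/seteqP; split=> [a ha|_ -> //]; apply: h2 => // b /(trunc_absorbsP b he).
exact: h.
Qed.

Lemma minimal_tripotentsP e : minimal_tripotents t e <->
  [/\ tripotent t e, e <> 0 & forall a c, a <> 0 -> truncation t a (t e c e) ->
   exists c', truncation t e (t a c' a)].
Proof.
split=> [[he h2 hn0]|[he e0 h]].
  split=> //.
    by move=> e0; apply: hn0; apply/seteqP; split=> [_ [k _ <-]|_ ->];
      [rewrite e0 scaler0 | exists 0; rewrite ?scale0r].
  move=> a c a0 hac; have [|c' hc'] := trunc_of_minimal jt he _ a0 hac.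
    move=> b hb; have : peirce t 2 e b by [].
    by rewrite h2 => -[k _ <-]; exists k.
  by exists c'; rewrite /truncation he hc'.
have hinv := invertible_of_trunc jt he.
split=> //; last first.
  move=> h0; apply: e0; have : range (fun k : R[i] => k *: e) e.
    by exists 1; rewrite ?scale1r.
  by rewrite h0.
apply/seteqP; split=> [b hb|_ [k _ <-]]; last first.
  exact/(peirceZ jt)/(peirce2_self he).
have [|k ->] := peirce2_scalar ht he e0 _ hb; last by exists k.
apply: hinv => a c a0 /(h a c a0)[c' hc']; exists c'.
by rewrite -hc' he.
Qed.

End TruncationCharacterizations.

(** * Transfer along the bijection *)

Section Transfer.
Variables (R : realType) (E F : completeNormedModType R[i]).
Variables (tE : E -> E -> E -> E) (tF : F -> F -> F -> F).
Variables (D : E -> F) (G : F -> E).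
Hypothesis hE : is_JBstar_triple tE.
Hypothesis hF : is_JBstar_triple tF.
Hypothesis DK : cancel D G.
Hypothesis GK : cancel G D.
Hypothesis hD : preserves_truncation_of_triple_products tE tF D.

Lemma preserves_truncation_inv : preserves_truncation_of_triple_products tF tE G.
Proof.
by move=> a b c; apply: iff_sym; have := hD (G a) (G b) (G c); rewrite !GK.
Qed.

Lemma preserves_tripotent e : tripotent tE e <-> tripotent tF (D e).
Proof. by rewrite !tripotentP. Qed.

(** As 0 is a truncation of every element, its preimage is a truncation of {0,0,0} = 0 and so has
    zero cube. *)
Lemma preserves0 : D 0 = 0.
Proof.
have jE := jordan_triple_of_JBstar hE; have jF := jordan_triple_of_JBstar hF.
suff h : G 0 = 0 by rewrite -h GK.
apply: (jt_anisotropic jE).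
have : truncation tE (G 0) (tE 0 0 0).
  by apply/hD; rewrite GK /truncation !(t0l jF).
by rewrite /truncation !(t0l jE) (t0m jE).
Qed.

Lemma preserves_trunc_absorbs e b :
  trunc_absorbs tE e b <-> trunc_absorbs tF (D e) (D b).
Proof.
split=> h c; last by rewrite !hD; exact: h.
by have := h (G c); rewrite !hD GK.
Qed.

Lemma preserves_tripotent_le e v : tripotent tE e -> tripotent tE v ->
  (tripotent_le tE e v <-> tripotent_le tF (D e) (D v)).
Proof.
move=> he hv; have he' := iffLR (preserves_tripotent e) he.
have hv' := iffLR (preserves_tripotent v) hv.
by rewrite !tripotent_leP // hD preserves_trunc_absorbs.
Qed.

Lemma preserves_order_minimal e :
  order_minimal_tripotents tE e -> order_minimal_tripotents tF (D e).
Proof.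
move=> [he e0 hmin]; split; first exact/preserves_tripotent.
  by move=> De0; apply: e0; rewrite -(DK e) De0 -preserves0 DK.
move=> u hu u0 hue; have hGu : tripotent tE (G u).
  by apply/preserves_tripotent; rewrite GK.
rewrite -(hmin (G u)) ?GK //.
  by move=> Gu0; apply: u0; rewrite -(GK u) Gu0 preserves0.
by apply/(preserves_tripotent_le hGu he); rewrite GK.
Qed.

Lemma preserves_order_maximal e :
  order_maximal_tripotents tE e -> order_maximal_tripotents tF (D e).
Proof.
move=> [he hmax]; split; first exact/preserves_tripotent.
move=> u hu heu; have hGu : tripotent tE (G u).
  by apply/preserves_tripotent; rewrite GK.
rewrite -(hmax (G u)) ?GK //.
by apply/(preserves_tripotent_le he hGu); rewrite GK.
Qed.

Lemma preserves_maximal e :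
  maximal_tripotents tE e -> maximal_tripotents tF (D e).
Proof.
move=> /(maximal_tripotentsP hE)[he h]; apply/(maximal_tripotentsP hF).
split=> [|b hb a c hac]; first exact/preserves_tripotent.
have hGb : trunc_absorbs tE e (G b).
  by apply/preserves_trunc_absorbs; rewrite GK.
have [|c' hc'] := h _ hGb (G a) (G c).
- by apply/hD; rewrite !GK.
- by exists (D c'); move/hD: hc'; rewrite GK.
Qed.

Lemma preserves_minimal e :
  minimal_tripotents tE e -> minimal_tripotents tF (D e).
Proof.
move=> /(minimal_tripotentsP hE)[he e0 h]; apply/(minimal_tripotentsP hF).
split=> [||a c a0 hac]; first exact/preserves_tripotent.
  by move=> De0; apply: e0; rewrite -(DK e) De0 -preserves0 DK.
have [||c' hc'] := h (G a) (G c).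
- by move=> Ga0; apply: a0; rewrite -(GK a) Ga0 preserves0.
- by apply/hD; rewrite !GK.
- by exists (D c'); move/hD: hc'; rewrite GK.
Qed.

End Transfer.

Lemma image_eq_of_inverse (T U : Type) (D : T -> U) (G : U -> T)
    (A : set T) (B : set U) : cancel G D ->
  (forall x, A x -> B (D x)) -> (forall y, B y -> A (G y)) -> D @` A = B.
Proof.
move=> GK hA hB; apply/seteqP; split=> [_ [x Ax <-]|y By]; first exact: hA.
by exists (G y); [exact: hB | exact: GK].
Qed.

Theorem lemma3p5 (R : realType) (E F : completeNormedModType R[i])
    (tE : E -> E -> E -> E) (tF : F -> F -> F -> F)
    (hE : is_JBstar_triple tE) (hF : is_JBstar_triple tF)
    (Delta : E -> F) (Delta_bij : bijective Delta)
    (Delta_trunc : preserves_truncation_of_triple_products tE tF Delta) :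
  (forall e, tripotent tE e <-> tripotent tF (Delta e)) /\
  (forall e v, tripotent tE e -> tripotent tE v ->
     (tripotent_le tE e v <-> tripotent_le tF (Delta e) (Delta v))) /\
  Delta @` order_minimal_tripotents tE = order_minimal_tripotents tF /\
  Delta @` order_maximal_tripotents tE = order_maximal_tripotents tF /\
  Delta @` minimal_tripotents tE = minimal_tripotents tF /\
  Delta @` maximal_tripotents tE = maximal_tripotents tF.
Proof.
have [G DK GK] := Delta_bij.
(* The inverse preserves truncations too, so each inclusion of images also holds backwards. *)
have G_trunc := preserves_truncation_inv GK Delta_trunc.
split; first exact: preserves_tripotent hE hF Delta_trunc.
split; first exact: preserves_tripotent_le hE hF GK Delta_trunc.
split; [|split; [|split]]; apply: (image_eq_of_inverse GK).
- exact: preserves_order_minimal hE hF DK GK Delta_trunc.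
- exact: preserves_order_minimal hF hE GK DK G_trunc.
- exact: preserves_order_maximal hE hF GK Delta_trunc.
- exact: preserves_order_maximal hF hE DK G_trunc.
- exact: preserves_minimal hE hF DK GK Delta_trunc.
- exact: preserves_minimal hF hE GK DK G_trunc.
- exact: preserves_maximal hE hF GK Delta_trunc.
- exact: preserves_maximal hF hE DK G_trunc.
Qed.
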